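(* Let $n\ge 1$ and let $\mathcal{H}\subseteq \binom{[n]}{\le 3}$ be a downset. Then $\mathcal{H}$ is EKR. Moreover, $\mathcal{H}$ is strictly EKR, unless one of the following holds. (1) There is a subset $K\in\binom{[n]}{4}$ such that (i) $\binom{K}{3}\subseteq\mathcal{H}$, (ii) for all $H\in\mathcal{H}$, $H\subseteq K$ or $K\cap H=\emptyset$, and (iii) the largest star in $\mathcal{H}$ has size $7$. (2) There are subsets $K\in\binom{[n]}{3}$ and (possibly empty) $M\subseteq[n]\setminus K$ such that the family $$\mathcal{Z}=\binom{K}{2}\cup\left\{Z\in\binom{K\cup M}{3} : |Z\cap K|=2\right\}$$ satisfies $\mathcal{Z}\subseteq\mathcal{H}$, and either (i) $K\notin\mathcal{H}$ and the largest star in $\mathcal{H}$ has size $|\mathcal{Z}|=3|M|+3$, or (ii) $K\in\mathcal{H}$ and the largest star in $\mathcal{H}$ has size $|\mathcal{Z}|+1=3|M|+4$.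
   Context: $[n]=\{1,\ldots,n\}$. For a finite set $X$, $\binom{X}{k}$ is the family of all $k$-element subsets of $X$, and $\binom{[n]}{\le r}$ is the family of all subsets of $[n]$ of size at most $r$. A family $\mathcal{F}\subseteq 2^{[n]}$ is a downset if $A\in\mathcal{F}$ and $B\subseteq A$ imply $B\in\mathcal{F}$. A family $\mathcal{F}$ is intersecting if $A\cap B\ne\emptyset$ for every $A,B\in\mathcal{F}$ (including $A=B$, so an intersecting family does not contain $\emptyset$). For $\mathcal{F}\subseteq 2^{[n]}$ and $x\in[n]$, the $\mathcal{F}$-star centered at $x$ is $\mathcal{F}_x=\{A\in\mathcal{F}: x\in A\}$. The largest star in $\mathcal{H}$ is an $\mathcal{H}$-star $\mathcal{H}_x$ of maximum size over $x\in[n]$. Let $\iota(\mathcal{F})$ be the size of the largest intersecting subfamily of $\mathcal{F}$, and $\sigma(\mathcal{F})=\max_{x\in[n]}|\mathcal{F}_x|$. The family $\mathcal{F}$ is EKR if $\iota(\mathcal{F})=\sigma(\mathcal{F})$. It is strictly EKR if, moreover, all of the largest (maximum-size) intersecting subfamilies of $\mathcal{F}$ are $\mathcal{F}$-stars. *)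

(* Defs.v *)
From mathcomp Require Import all_boot.

Set Implicit Arguments.
Unset Strict Implicit.
Unset Printing Implicit Defensive.

Section Families.

Variable T : finType.
Implicit Types (F G : {set {set T}}) (K M X : {set T}) (x : T) (k : nat).

Definition ksubsets X k : {set {set T}} :=
  [set A : {set T} | (A \subset X) && (#|A| == k)].

Definition subsets_le k : {set {set T}} := [set A : {set T} | #|A| <= k].

Definition downset F : bool :=
  [forall A in F, forall B : {set T}, (B \subset A) ==> (B \in F)].

(* A and B range independently, so A = B is allowed and set0 is excluded from
   every intersecting family. The empty family is intersecting. *)
Definition intersecting F : bool :=
  [forall A in F, forall B in F, A :&: B != set0].

Definition star F x : {set {set T}} := [set A in F | x \in A].

Definition max_intersecting F : nat :=
  \max_(G : {set {set T}} | (G \subset F) && intersecting G) #|G|.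

Definition max_star F : nat := \max_(x : T) #|star F x|.

Definition EKR F : Prop := max_intersecting F = max_star F.

Definition strictly_EKR F : Prop :=
  EKR F /\
  forall G, G \subset F -> intersecting G -> #|G| = max_intersecting F ->
    exists x, G = star F x.

Definition Zfamily K M : {set {set T}} :=
  ksubsets K 2 :|: [set Z in ksubsets (K :|: M) 3 | #|Z :&: K| == 2].

End Families.

(* Main.v *)
Require Import Defs.
From mathcomp Require Import all_boot zify.

Set Implicit Arguments.
Unset Strict Implicit.
Unset Printing Implicit Defensive.

(** Let [G] be an intersecting subfamily of [H] that lies in no star, and
suppose that every [H]-star has at most [#|G|] members.  For [x] covered by [G],
the star at [x] contains [{x}] and all pairs [{x, v}] of [H] outside [G], so there
are fewer such pairs than members of [G] avoiding [x].

If no two points meet every member of [G], then [G] consists of triples.  For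
[x] of maximum degree, let [N] be the set of points that lie in a common triple
with [x].  Double counting incidences with [N] shows that at most [#|N|] members
of [G] avoid [x], which is a contradiction.

If [{a, b}] meets every member of [G], then the links of [a] and [b] are
cross-intersecting families of sets of size 1 or 2, and the two inequalities
above leave only three shapes: a tetrahedron, a triangle of pairs in [G], or a
star.  The equality cases of the first two are the exceptions of the theorem. *)

Ltac case_eq_op z := repeat match goal with |- context [z == ?t] => case: (z == t) end.

(** [clear] empties the context, so every fact to be used is first moved into the goal; cardinals
    then become plain variables for [lia]. *)
Ltac card_lia :=
  clear; repeat match goal with |- context [@card ?T ?A] => move: (@card T A) end;
  lia.

Ltac split_andb :=
  repeat match goal with H : is_true (_ && _) |- _ => case/andP: H => ? ? end.

Ltac distinct U :=
  move: U; rewrite /= ?inE ?negb_or ?andbT; move=> U; split_andb;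
  repeat (apply/andP; split); try done; by rewrite eq_sym.

(** * Counting in finite set systems *)

Section FinsetFacts.
Variable T : finType.
Implicit Types (S : {set T}) (F : {set {set T}}).

Lemma uniq_size_le_card (s : seq T) S : uniq s -> all [in S] s -> size s <= #|S|.
Proof. by move=> /card_uniqP <- /allP sS; apply/subset_leq_card/subsetP. Qed.

Lemma count_le_card (s : seq T) S : uniq s -> count [in S] s <= #|S|.
Proof.
move=> U; rewrite -size_filter; apply: uniq_size_le_card (filter_all _ _).
exact: filter_uniq.
Qed.

Lemma set3_eq S a b c :
  #|S| = 3 -> uniq [:: a; b; c] -> a \in S -> b \in S -> c \in S ->
  S = [set a; b; c].
Proof.
move=> S3 U aS bS cS; apply/esym/eqP; rewrite eqEcard S3; apply/andP; split.
  by apply/subsetP => z; rewrite !inE => /orP[/orP[]|] /eqP->.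
by apply: (@uniq_size_le_card [:: a; b; c]) => //=; rewrite !inE !eqxx !orbT.
Qed.

Lemma set2_eq S a b :
  #|S| <= 2 -> a != b -> a \in S -> b \in S -> S = [set a; b].
Proof.
move=> S2 ab aS bS; apply/esym/eqP; rewrite eqEcard cards2 ab S2 andbT.
by apply/subsetP => z; rewrite !inE => /orP[] /eqP->.
Qed.

Lemma card3P S x y :
  #|S| = 3 -> x \in S -> y \in S -> x != y ->
  exists z, [/\ z != x, z != y & S = [set x; y; z]].
Proof.
move=> S3 xS yS xy.
have : 0 < #|S :\ x :\ y|.
  have := cardsD1 x S; have := cardsD1 y (S :\ x).
  rewrite S3 xS !inE eq_sym xy yS /=; card_lia.
case/card_gt0P => z; rewrite !inE => /and3P[zy zx zS].
exists z; split=> //; apply: set3_eq => //=.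
by rewrite !inE (negPf xy) eq_sym (negPf zx) eq_sym (negPf zy).
Qed.

(** Double counting of the pairs [(y, A)] with [y] in [A :&: S]. *)
Lemma sum_card_star F S :
  \sum_(y in S) #|star F y| = \sum_(A in F) #|A :&: S|.
Proof.
under eq_bigr => y _ do rewrite /star -sum1dep_card big_mkcondr.
rewrite exchange_big /=; apply: eq_bigr => A _.
rewrite -big_mkcondr sum1dep_card; apply: eq_card => z.
by rewrite !inE andbC.
Qed.

Definition avoid F x := [set S in F | x \notin S].

Lemma card_star_avoid F x : #|star F x| + #|avoid F x| = #|F|.
Proof.
rewrite -(cardsID [set S : {set T} | x \in S] F); congr (_ + _); apply: eq_card => S.
  by rewrite !inE.
by rewrite !inE andbC.
Qed.

Definition nbhd F x := [set v | (v != x) && [exists S in star F x, v \in S]].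

Lemma nbhdP F x v :
  reflect (v != x /\ exists S, [/\ S \in F, x \in S & v \in S]) (v \in nbhd F x).
Proof.
rewrite inE; apply: (iffP andP) => -[vx].
  by case/exists_inP => S; rewrite inE => /andP[SF xS] vS; split=> //; exists S.
by move=> [S [SF xS vS]]; split=> //; apply/exists_inP; exists S; rewrite // inE SF.
Qed.

End FinsetFacts.

(** * Triples without a two-point cover *)

Section NoTwoCover.
Variables (T : finType) (G : {set {set T}}).
Hypothesis G3 : {in G, forall S : {set T}, #|S| = 3}.
Hypothesis GI : {in G &, forall A B : {set T}, A :&: B != set0}.
Hypothesis tau3 : forall u v, exists2 S, S \in G & (u \notin S) && (v \notin S).

Lemma meets A B : A \in G -> B \in G -> exists2 z, z \in A & z \in B.
Proof. by move=> AG /(GI AG)/set0Pn[z]; rewrite inE => /andP[]; exists z. Qed.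

(** * The link graph of a vertex *)

Section Vertex.
Variable x : T.
Let N := nbhd G x.
(** The link of [x] in [G], read as a graph on [N]: its edges are the triples through [x] with [x]
    removed. *)
Let adj y z := [&& y != z, y != x, z != x & [set x; y; z] \in G].

Lemma adjC y z : adj y z = adj z y.
Proof.
rewrite /adj eq_sym; congr (_ && _); rewrite andbCA; do 2!congr (_ && _).
by rewrite -!setUA [[set y] :|: _]setUC.
Qed.

Lemma adj_nbhd y z : adj y z -> y \in N.
Proof.
case/and4P=> yz yx zx SG; apply/nbhdP; split=> //.
by exists [set x; y; z]; rewrite SG !inE !eqxx !orbT.
Qed.

Lemma nbhd_adj y : y \in N -> exists z, adj y z.
Proof.
case/nbhdP=> yx [S [SG xS yS]].
have xy : x != y by rewrite eq_sym.
have [z [zx zy eS]] := card3P (G3 SG) xS yS xy.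
by exists z; rewrite /adj -eS SG zx yx eq_sym zy.
Qed.

Lemma star_adj S : S \in G -> x \in S ->
  exists y z, [/\ adj y z & S = [set x; y; z]].
Proof.
move=> SG xS.
have : 0 < #|S :\ x| by have := cardsD1 x S; rewrite (G3 SG) xS; card_lia.
case/card_gt0P=> y; rewrite !inE => /andP[yx yS].
have xy : x != y by rewrite eq_sym.
have [z [zx zy eS]] := card3P (G3 SG) xS yS xy.
by exists y, z; rewrite /adj -eS SG zx yx eq_sym zy.
Qed.

(** [S] meets the triple [{x, y, z}] outside [x]. Thus every member avoiding [x] is a vertex cover
    of the link graph. *)
Lemma avoid_adj S y z : S \in avoid G x -> adj y z -> (y \in S) || (z \in S).
Proof.
rewrite inE => /andP[SG xS] /and4P[_ _ _ yzG].
have [t] := meets SG yzG; rewrite !inE => tS /orP[/orP[]|] /eqP te.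
- by rewrite -te tS in xS.
- by rewrite -te tS.
- by rewrite -te tS orbT.
Qed.

(* A member of [G] that avoids [p] and [q] must meet [{x, p, q}] in [x]. *)
Lemma disjoint_adj p q : adj p q -> exists r s, adj r s /\ uniq [:: p; q; r; s].
Proof.
move=> pq; have [S SG /andP[pS qS]] := tau3 p q.
have xS : x \in S.
  apply/negPn/negP => xS; have := @avoid_adj S p q.
  by rewrite inE SG xS (negPf pS) (negPf qS) => /(_ isT pq).
have [r [s [rs eS]]] := star_adj SG xS; exists r, s; split=> //.
move: pS qS; rewrite eS !inE !negb_or => /andP[/andP[_ pr] ps] /andP[/andP[_ qr] qs].
case/and4P: pq => pq _ _ _; case/and4P: rs => rs _ _ _.
by rewrite /= !inE !negb_or pq pr ps qr qs rs.
Qed.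

Lemma star_card_nbhd S : S \in star G x -> #|S :&: N| = 2.
Proof.
rewrite inE => /andP[SG xS]; have [y [z [yz eS]]] := star_adj SG xS.
suff -> : S :&: N = [set y; z] by case/and4P: (yz) => e _ _ _; rewrite cards2 e.
apply/setP=> t; rewrite eS !inE.
case: (eqVneq t x) => [->|tx] /=.
  by case/and4P: (yz) => _ yx zx _; rewrite ![x == _]eq_sym (negPf yx) (negPf zx).
case: (boolP (_ || _)) => //= /orP[] /eqP->.
  by have := adj_nbhd yz; rewrite inE => /andP[].
by move: yz; rewrite adjC => /adj_nbhd; rewrite inE => /andP[].
Qed.

Hypothesis xG : exists2 S, S \in G & x \in S.

Lemma nbhd_two_edges : exists p q r s,
  [/\ adj p q, adj r s & uniq [:: p; q; r; s]].
Proof.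
case: xG => S SG xS; have [p [q [pq _]]] := star_adj SG xS.
by have [r [s [rs U]]] := disjoint_adj pq; exists p, q, r, s.
Qed.

Lemma card_nbhd_ge4 : 4 <= #|N|.
Proof.
have [p [q [r [s [pq rs U]]]]] := nbhd_two_edges.
apply: (@uniq_size_le_card _ [:: p; q; r; s]) => //=.
by rewrite (adj_nbhd pq) (adj_nbhd rs); move: pq rs; rewrite adjC => /adj_nbhd->;
   rewrite adjC => /adj_nbhd->.
Qed.

(** A vertex cover takes an end of each of two disjoint link edges. *)
Lemma avoid_card_nbhd S : S \in avoid G x -> 2 <= #|S :&: N|.
Proof.
move=> SG; have [p [q [r [s [pq rs U]]]]] := nbhd_two_edges.
have [pN rN] := (adj_nbhd pq, adj_nbhd rs).
have [qN sN] : q \in N /\ s \in N.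
  by split; [move: pq | move: rs]; rewrite adjC => /adj_nbhd.
have two a b : a \in S -> b \in S -> a \in N -> b \in N -> a != b -> 2 <= #|S :&: N|.
  move=> aS bS aN bN ab; apply: (@uniq_size_le_card _ [:: a; b]).
    by rewrite /= inE ab.
  by rewrite /= !in_setI aS bS aN bN.
move: U => /=; rewrite !inE !negb_or => /and4P[/and3P[_ pr ps] /andP[qr qs] _ _].
case/orP: (avoid_adj SG pq) => aS; case/orP: (avoid_adj SG rs) => bS.
- exact: two pr.
- exact: two ps.
- exact: two qr.
- exact: two qs.
Qed.

(* A member of [G] avoiding [S :&: N] meets [S] outside [N], so it has at most two
   points in [N], and every link edge joins one of them to [S :&: N]. *)
Lemma avoid_not_sub S : S \in avoid G x -> ~~ (S \subset N) ->
  #|N| = 4 /\ #|star G x| <= 4.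
Proof.
move=> Sav /subsetPn[z zS zN].
have SG : S \in G by move: Sav; rewrite inE => /andP[].
have cU : #|S :&: N| = 2.
  have := avoid_card_nbhd Sav; have := cardsID N S; rewrite (G3 SG).
  suff : 0 < #|S :\: N| by card_lia.
  by apply/card_gt0P; exists z; rewrite in_setD zN.
have [u [v [uv eU]]] := cards2P _ (introT eqP cU).
have [R RG /andP[uR vR]] := tau3 u v.
have UR y : y \in N -> y \in S -> y \notin R.
  move=> yN yS; have : y \in S :&: N by rewrite in_setI yS.
  by rewrite eU !inE => /orP[] /eqP->.
have Rav : R \in avoid G x.
  rewrite inE RG; apply/negP => xR; have [y [w [yw eR]]] := star_adj RG xR.
  have yN := adj_nbhd yw; have : w \in N by move: yw; rewrite adjC => /adj_nbhd.
  move=> wN; case/orP: (avoid_adj Sav yw) => [/(UR _ yN)|/(UR _ wN)];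
  by rewrite eR !inE eqxx ?orbT.
have [t tS tR] := meets SG RG.
have cW : #|R :&: N| <= 2.
  have := cardsID N R; rewrite (G3 RG).
  suff : 0 < #|R :\: N| by card_lia.
  apply/card_gt0P; exists t; rewrite in_setD tR andbT.
  by apply: contraL tR => tN; exact: UR.
have cross y w : adj y w -> y \in S -> w \in R.
  move=> yw yS; have := avoid_adj Rav yw.
  by rewrite (negPf (UR _ (adj_nbhd yw) yS)).
split.
  apply/eqP; rewrite eqn_leq card_nbhd_ge4 andbT.
  apply: leq_trans (_ : #|S :&: N :|: R :&: N| <= 4).
    apply/subset_leq_card/subsetP => y yN.
    rewrite in_setU !in_setI yN !andbT.
    have [w yw] := nbhd_adj yN.
    case/orP: (avoid_adj Sav yw) => [->//|wS].
    by rewrite (cross w y) ?orbT // adjC.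
  by rewrite cardsU cU; move: cW; card_lia.
apply: leq_trans (_ : #|[set [set x; p.1; p.2] | p in setX (S :&: N) (R :&: N)]| <= 4); last first.
  by apply: leq_trans (leq_imset_card _ _) _; rewrite cardsX cU; move: cW; card_lia.
apply/subset_leq_card/subsetP => Q; rewrite inE => /andP[QG xQ].
have [y [w [yw ->]]] := star_adj QG xQ.
have yN := adj_nbhd yw; have wN : w \in N by move: yw; rewrite adjC => /adj_nbhd.
case/orP: (avoid_adj Sav yw) => aS; apply/imsetP.
  by exists (y, w); rewrite ?in_setX ?in_setI ?yN ?wN ?aS ?(cross y).
exists (w, y); last by rewrite /= -!setUA [[set y] :|: _]setUC.
by rewrite in_setX !in_setI yN wN aS (cross w) // adjC.
Qed.

(** A triple through [x] has exactly its two other points in [N], which gives the first term of the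
    double count. *)
Lemma sum_star_nbhd : \sum_(y in N) #|star G y| =
  2 * #|star G x| + \sum_(S in avoid G x) #|S :&: N|.
Proof.
rewrite sum_card_star (bigID (fun S : {set T} => x \in S)) /=; congr (_ + _).
  rewrite mulnC -sum_nat_const.
  rewrite [RHS](eq_bigl (fun S => (S \in G) && (x \in S))); last first.
    by move=> S; rewrite inE.
  by apply: eq_bigr => S SG; apply: star_card_nbhd; rewrite inE.
by apply: eq_bigl => S; rewrite inE.
Qed.

(* [S] picks one end of each edge; complementary choices give disjoint sets, so at
   most half of the eight choices occur. *)
Lemma three_edges p q r s t w :
  adj p q -> adj r s -> adj t w -> uniq [:: p; q; r; s; t; w] ->
  #|avoid G x| <= 4.
Proof.
move=> pq rs tw U.
have one S : S \in avoid G x ->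
  [/\ (q \in S) = (p \notin S), (s \in S) = (r \notin S),
      (w \in S) = (t \notin S) & {subset S <= [:: p; q; r; s; t; w]}].
  move=> Sav; have S3 : #|S| = 3 by apply: G3; move: Sav; rewrite inE => /andP[].
  (* Three points cover three disjoint edges, so [S] has exactly one end of each edge and nothing
     else. *)
  have := avoid_adj Sav pq; have := avoid_adj Sav rs; have := avoid_adj Sav tw.
  move=> tw' rs' pq'; split.
  - have := count_le_card S U; rewrite /= S3; move: tw' rs' pq'; by do 6!case: (_ \in S).
  - have := count_le_card S U; rewrite /= S3; move: tw' rs' pq'; by do 6!case: (_ \in S).
  - have := count_le_card S U; rewrite /= S3; move: tw' rs' pq'; by do 6!case: (_ \in S).
  move=> z zS; apply/negPn/negP => zl.
  have := @count_le_card _ (z :: [:: p; q; r; s; t; w]) S.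
  rewrite cons_uniq zl U => /(_ isT); rewrite /= zS S3; move: tw' rs' pq'; by do 6!case: (_ \in S).
(* [f] is unchanged when the choice is reversed on all three edges, so its four values label the
   complementary pairs of choices. *)
pose f (S : {set T}) := ((p \in S) (+) (r \in S), (p \in S) (+) (t \in S)).
rewrite -(@card_in_imset _ _ f).
  by apply: leq_trans (max_card _) _; rewrite card_prod card_bool.
move=> S R Sav Rav [e1 e2].
have [Sq Ss Sw Sl] := one _ Sav; have [Rq Rs Rw Rl] := one _ Rav.
case: (boolP ((p \in S) == (p \in R))) => [/eqP ep|np].
  have er : (r \in S) = (r \in R) by move: e1; rewrite ep; do 3!case: (_ \in _).
  have et : (t \in S) = (t \in R) by move: e2; rewrite ep; do 3!case: (_ \in _).
  apply/setP => z; case: (boolP (z \in [:: p; q; r; s; t; w])) => [|zl].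
    by rewrite !inE; do 5?[case/orP]; move/eqP=> ->;
       rewrite ?Sq ?Rq ?Ss ?Rs ?Sw ?Rw ?ep ?er ?et.
  by rewrite (negPf (contra (@Sl z) zl)) (negPf (contra (@Rl z) zl)).
(* Here [S] and [R] make opposite choices on every edge and would be disjoint. *)
have ep : (p \in R) = (p \notin S) by move: np; do 2!case: (_ \in _).
have er : (r \in R) = (r \notin S) by move: e1; rewrite ep; do 3!case: (_ \in _).
have et : (t \in R) = (t \notin S) by move: e2; rewrite ep; do 3!case: (_ \in _).
have [SG RG] : S \in G /\ R \in G.
  by split; [move: Sav | move: Rav]; rewrite inE => /andP[].
have [z zS] := meets SG RG; move: (zS) => /Sl.
rewrite !inE; do 5?[case/orP]; move/eqP=> ez; move: zS; rewrite ez;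
 rewrite ?Sq ?Rq ?Ss ?Rs ?Sw ?Rw ?ep ?er ?et; by case: (_ \in _).
Qed.

(** A triple avoiding [x] and [p] would have to contain [q], [i], [j] and one end of the edge [rs],
    which is four points. *)
Lemma common_neighbour p q r s i j :
  adj p q -> adj r s -> adj i p -> adj j p -> uniq [:: p; q; r; s; i; j] ->
  False.
Proof.
move=> pq rs ip jp U; have [S SG /andP[xS pS]] := tau3 x p.
have Sav : S \in avoid G x by rewrite inE SG.
have U' : uniq [:: q; i; j; r; s] by distinct U.
have := count_le_card S U'; rewrite /= (G3 SG).
have := avoid_adj Sav pq; have := avoid_adj Sav rs.
have := avoid_adj Sav ip; have := avoid_adj Sav jp.
by rewrite (negPf pS); do 5!case: (_ \in S).
Qed.

(** The link contains the paths [q - p - i] and [s - r - j]. A cover omitting [p] is [{q, i, r}],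
    one omitting [r] is [{s, j, p}], and one containing both has its third point in a fixed member
    [R] that avoids [p] and [r]: at most [1 + 1 + 3] sets. *)
Lemma two_paths p q r s i j :
  adj p q -> adj r s -> adj i p -> adj j r -> uniq [:: p; q; r; s; i; j] ->
  #|avoid G x| <= 5.
Proof.
move=> pq rs ip jr U; have [R RG /andP[pR rR]] := tau3 p r.
pose F := [set q; i; r] |: ([set s; j; p] |: [set [set p; r; z] | z in R]).
apply: leq_trans (_ : #|F| <= 5); last first.
  rewrite !cardsU1; have := leq_imset_card (fun z => [set p; r; z]) R.
  by rewrite (G3 RG); do 2!case: (_ \notin _); card_lia.
apply/subset_leq_card/subsetP => S Sav.
have SG : S \in G by move: Sav; rewrite inE => /andP[].
have := avoid_adj Sav pq; have := avoid_adj Sav rs.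
have := avoid_adj Sav ip; have := avoid_adj Sav jr.
rewrite /F !in_setU1.
case: (boolP (p \in S)) => pS; last first.
  rewrite /= orbF => jr' iS rs' qS; case: (boolP (r \in S)) => rS.
    by rewrite (@set3_eq _ S q i r) ?eqxx ?G3 //; distinct U.
  move: jr' rs'; rewrite (negPf rS) /= orbF => jS sS.
  have U' : uniq [:: q; i; j; s] by distinct U.
  by have := count_le_card S U'; rewrite /= qS iS jS sS (G3 SG).
case: (boolP (r \in S)) => rS.
  move=> _ _ _ _; have [z zS zR] := meets SG RG.
  apply/orP; right; apply/orP; right; apply/imsetP; exists z => //.
  have pr : p != r by distinct U.
  apply: set3_eq; rewrite ?G3 //= !inE negb_or pr /= andbT.
  by apply/andP; split; [apply: contraNneq pR | apply: contraNneq rR] => ->.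
rewrite /= orbF => jS _ sS _; apply/orP; right; apply/orP; left.
by rewrite (@set3_eq _ S s j p) ?eqxx ?G3 //; distinct U.
Qed.

(** Cases on a neighbour [l] of [j]. A point outside [{p, q, r, s}], or [q], yields three disjoint
    edges; [p] is excluded by [common_neighbour]; [r] or [s] yields two disjoint paths. *)
Lemma card_avoid_path p q r s i j :
  adj p q -> adj r s -> adj i p -> j \in N -> uniq [:: p; q; r; s; i; j] ->
  #|avoid G x| <= 5.
Proof.
move=> pq rs ip /nbhd_adj[l jl] U.
case: (boolP (l \in [:: p; q; r; s])) => [|lN]; last first.
  apply/leqW/(three_edges pq rs jl).
  have jl' : j != l by case/and4P: jl.
  by move: U; rewrite /= !inE !negb_or in lN *; move=> U;
    split_andb; repeat (apply/andP; split); rewrite // eq_sym.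
rewrite !inE => /or4P[] /eqP el; rewrite el in jl.
- by case: (common_neighbour pq rs ip jl U).
- by apply/leqW/(three_edges ip jl rs); distinct U.
- exact: (two_paths pq rs ip jl U).
- by rewrite adjC in rs; apply: (two_paths pq rs ip jl); distinct U.
Qed.

(* Two disjoint link edges and two further points of [N]: depending on how those
   points are attached, there are three disjoint edges or two disjoint paths. *)
Lemma card_avoid_ge6 : 6 <= #|N| -> #|avoid G x| <= 5.
Proof.
move=> N6; have [p [q [r [s [pq rs U]]]]] := nbhd_two_edges.
have : 1 < #|N :\: [set t in [:: p; q; r; s]]|.
  have := cardsID [set t in [:: p; q; r; s]] N.
  have : #|N :&: [set t in [:: p; q; r; s]]| <= 4.
    apply: leq_trans (subset_leq_card (subsetIr _ _)) _.
    by rewrite cardsE; exact: card_size.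
  move: N6; card_lia.
case/card_gt1P => i [j []]; rewrite !in_setD ![_ \in [set _ in _]]inE.
move=> /andP[il iN] /andP[jl jN] ij.
have U6 : uniq [:: p; q; r; s; i; j].
  by move: U il jl ij; rewrite /= !inE !negb_or => U il jl ij;
    split_andb; repeat (apply/andP; split); rewrite // eq_sym.
have [k ik] := nbhd_adj iN.
case: (boolP (k \in [:: p; q; r; s])) => [|kN]; last first.
  apply/leqW/(three_edges pq rs ik).
  have ik' : i != k by case/and4P: ik.
  by move: U6 kN; rewrite /= !inE !negb_or => U6 kN;
    split_andb; repeat (apply/andP; split); rewrite // eq_sym.
have qp : adj q p by rewrite adjC.
have sr : adj s r by rewrite adjC.
rewrite !inE => /or4P[] /eqP ek; rewrite ek in ik.
- by apply: (card_avoid_path pq rs ik jN); distinct U6.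
- by apply: (card_avoid_path qp rs ik jN); distinct U6.
- by apply: (card_avoid_path rs pq ik jN); distinct U6.
- by apply: (card_avoid_path sr pq ik jN); distinct U6.
Qed.

Hypothesis xmax : forall y, #|star G y| <= #|star G x|.

Lemma sum_star_le : \sum_(y in N) #|star G y| <= #|N| * #|star G x|.
Proof. by rewrite -sum_nat_const; apply: leq_sum. Qed.

(** Write [d = #|star G x|] and [m = #|avoid G x|]. By maximality of [d] the incidence sum over [N]
    is at most [#|N| * d]. This settles the case of a member avoiding [x] that leaves [N], and it is
    combined with a count of pairs when [#|N| = 5]; the sizes 4 and at least 6 follow from direct
    bounds on [m]. *)
Lemma card_avoid_le_nbhd : #|avoid G x| <= #|N|.
Proof.
have := sum_star_le; rewrite sum_star_nbhd.
case: (boolP [forall S in avoid G x, S \subset N]) => [/forall_inP sub|]; last first.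
  rewrite negb_forall => /existsP[S]; rewrite negb_imply => /andP[Sav SN].
  (* Here [2d + 2m <= 4d], so [m <= d <= 4]. *)
  have [N4 d4] := avoid_not_sub Sav SN.
  have : \sum_(S in avoid G x) 2 <= \sum_(S in avoid G x) #|S :&: N|.
    by apply: leq_sum => R; exact: avoid_card_nbhd.
  rewrite sum_nat_const N4; move: d4; card_lia.
have -> : \sum_(S in avoid G x) #|S :&: N| = \sum_(S in avoid G x) 3.
  apply: eq_bigr => S Sav; rewrite (setIidPl (sub _ Sav)); apply: G3.
  by move: Sav; rewrite inE => /andP[].
rewrite sum_nat_const => sumle.
have N4 := card_nbhd_ge4.
have [N6|] := leqP 6 #|N|; first by have := card_avoid_ge6 N6; move: N6; card_lia.
have [/eqP N5 _|] := boolP (#|N| == 5); last first.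
  move=> N5 N6; have {N4 N5 N6} N4 : #|N| = 4 by move: N4 N5 N6; card_lia.
  apply: leq_trans (_ : #|ksubsets N 3| <= _).
    apply/subset_leq_card/subsetP => S Sav; rewrite inE (sub _ Sav) G3 //.
    by move: Sav; rewrite inE => /andP[].
  by rewrite cards_draws N4.
(* Now [2d + 3m <= 5d], that is [m <= d], so [m + d <= 10] suffices. The complements in [N] of
   members avoiding [x] and the links of members through [x] are disjoint families among the ten
   pairs of [N]. *)
suff : #|avoid G x| + #|star G x| <= 10 by move: sumle; rewrite N5; card_lia.
have -> : #|avoid G x| = #|[set N :\: S | S : {set T} in avoid G x]|.
  rewrite card_in_imset // => S R Sav Rav eSR.
  have DD Q : Q \in avoid G x -> N :\: (N :\: Q) = Q.
    by move=> Qav; rewrite setDDr setDv set0U; apply/setIidPr/sub.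
  by rewrite -(DD S) // eSR DD.
have -> : #|star G x| = #|[set S :\ x | S : {set T} in star G x]|.
  rewrite card_in_imset // => S R; rewrite !inE => /andP[_ xS] /andP[_ xR] eSR.
  by rewrite -(setD1K xS) eSR setD1K.
set A := imset _ _; set B := imset _ _.
(* A cover has an end of every link edge, so its complement in [N] is not an edge. *)
have : A :&: B = set0.
  apply/setP => Q; rewrite in_set0; apply/negP; rewrite in_setI => /andP[].
  case/imsetP => S Sav -> /imsetP[R]; rewrite inE => /andP[RG xR].
  have [y [z [yz ->]]] := star_adj RG xR.
  case/and4P: (yz) => _ yx zx _ /setP eS.
  have := eS y; have := eS z; rewrite !inE !eqxx !orbT yx zx /=.
  case/orP: (avoid_adj Sav yz) => ->; by [|case: (_ \in _)].
move=> AB0; have := cardsU A B; rewrite AB0 cards0 subn0 => <-.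
have <- : #|ksubsets N 2| = 10 by rewrite cards_draws N5.
apply/subset_leq_card/subsetP => Q; rewrite in_setU inE => /orP[] /imsetP[S].
  move=> Sav ->; rewrite subsetDl cardsD (setIidPr (sub _ Sav)) N5 G3 //.
  by move: Sav; rewrite inE => /andP[].
move=> Sx ->; have := star_card_nbhd Sx; move: (Sx); rewrite inE => /andP[SG xS].
have := cardsD1 x S; rewrite xS (G3 SG) add1n => -[<-] _; rewrite eqxx andbT.
apply/subsetP => y; rewrite !in_setD1 => /andP[yx yS].
by apply/nbhdP; split=> //; exists S.
Qed.

End Vertex.

Lemma exists_card_avoid_le_nbhd (x0 : T) :
  exists x, (exists2 S, S \in G & x \in S) /\ #|avoid G x| <= #|nbhd G x|.
Proof.
have [S SG _] := tau3 x0 x0.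
have /card_gt0P[y yS] : 0 < #|S| by rewrite G3.
case: (@arg_maxnP _ y xpredT (fun x => #|star G x|)) => // x _ xmax.
have xG : exists2 S, S \in G & x \in S.
  have /card_gt0P[R] : 0 < #|star G x|.
    by apply: leq_trans (xmax y isT); apply/card_gt0P; exists S; rewrite inE SG.
  by rewrite inE => /andP[RG xR]; exists R.
by exists x; split=> //; apply: card_avoid_le_nbhd => // y'; exact: xmax.
Qed.

End NoTwoCover.

(** * Cross-intersecting links *)

Section CrossIntersecting.
Variable T : finType.
Implicit Types (A B : {set {set T}}) (E : {set T}).

(* In the link of [a], these are the [v] with [{a, v}] in [H] but not in [G]. *)
Definition nonsingle A := [set v in cover A | [set v] \notin A].

Definition small A := [forall E in A, 0 < #|E| <= 2].

Lemma smallP A E : small A -> E \in A -> 0 < #|E| <= 2.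
Proof. by move=> /forall_inP sA; exact: sA. Qed.

Lemma nonsingleE A E v : E \in A -> v \in E ->
  (v \in nonsingle A) = ([set v] \notin A).
Proof. by move=> EA vE; rewrite inE; case: bigcupP => // -[]; exists E. Qed.

Definition cross_intersecting A B :=
  [forall E in A, forall F in B, E :&: F != set0].

Lemma crossP A B E F : cross_intersecting A B -> E \in A -> F \in B ->
  exists2 v, v \in E & v \in F.
Proof.
move=> /forall_inP AB /AB/forall_inP EB /EB/set0Pn[v].
by rewrite inE => /andP[]; exists v.
Qed.

Lemma cross_sym A B : cross_intersecting A B -> cross_intersecting B A.
Proof.
move=> AB; apply/forall_inP => F FB; apply/forall_inP => E EA.
by have [v vE vF] := crossP AB EA FB; apply/set0Pn; exists v; rewrite inE vF.
Qed.

Lemma cross_single A B u E : cross_intersecting A B -> [set u] \in A ->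
  E \in B -> u \in E.
Proof. by move=> AB uA /(crossP AB uA)[v]; rewrite inE => /eqP->. Qed.

(** Any member other than [{u}] is a pair [{u, y}], and [{y}] is not in [A] since it misses [u], so
    [y] lies in [nonsingle A]. *)
Lemma card_common A u : small A -> (forall E, E \in A -> u \in E) ->
  [set u] \in A -> #|A| <= (#|nonsingle A|).+1.
Proof.
move=> sA uA uu.
apply: leq_trans (_ : #|[set u] |: [set [set u; y] | y in nonsingle A]| <= _).
  apply/subset_leq_card/subsetP => E EA; rewrite in_setU1.
  case: eqVneq => //= Eu; apply/imsetP.
  have /andP[_ E2] := smallP sA EA.
  have /subsetPn[y yE] : ~~ (E \subset [set u]).
    by apply: contra Eu => /subset_leq_card; rewrite eq_sym eqEcard sub1set uA.
  rewrite inE => yu; exists y; last by apply: set2_eq; rewrite ?uA // eq_sym.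
  by rewrite (nonsingleE EA) //; apply: contraNN yu => /uA; rewrite inE eq_sym.
by rewrite cardsU1; have := leq_imset_card (fun y => [set u; y]) (nonsingle A);
  case: (_ \notin _); card_lia.
Qed.

(** As in [card_common], but every member is now a pair [{u, y}] and [u] itself also belongs to
    [nonsingle A]; hence the strict inequality. *)
Lemma card_common_nonsingle A u : small A -> (forall E, E \in A -> u \in E) ->
  [set u] \notin A -> A != set0 -> #|A| < #|nonsingle A|.
Proof.
move=> sA uA uu /set0Pn[E0 E0A].
have uN : u \in nonsingle A by rewrite (nonsingleE E0A) ?uA.
rewrite (cardsD1 u) uN add1n ltnS.
apply: leq_trans (_ : #|[set [set u; y] | y in nonsingle A :\ u]| <= _).
  apply/subset_leq_card/subsetP => E EA; apply/imsetP.
  have /andP[_ E2] := smallP sA EA.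
  have /subsetPn[y yE] : ~~ (E \subset [set u]).
    apply: contra uu => Eu; suff <- : E = [set u] by [].
    by apply/eqP; rewrite eqEsubset Eu sub1set uA.
  rewrite inE => yu; exists y; last by apply: set2_eq; rewrite ?uA // eq_sym.
  rewrite in_setD1 yu (nonsingleE EA) //.
  by apply: contraNN yu => /uA; rewrite inE eq_sym.
exact: leq_imset_card.
Qed.

(** Members of [B] contain [u] and [w], so [B] is a single pair. Then [nonsingle A] is empty, which
    confines [A] to subsets of [{u, w}], while [u] and [w] both lie in [nonsingle B], which forces
    three members in [A]. *)
Lemma two_singles A B u w :
    small A -> small B -> cross_intersecting A B -> B != set0 ->
    u != w -> [set u] \in A -> [set w] \in A ->
    #|nonsingle A| < #|B| -> #|nonsingle B| < #|A| ->
  A = [set [set u]; [set w]; [set u; w]] /\ B = [set [set u; w]].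
Proof.
move=> sA sB AB /set0Pn[F FB] uw uA wA nAB nBA.
have BE E : E \in B -> E = [set u; w].
  move=> EB; have /andP[_ E2] := smallP sB EB.
  by apply: set2_eq; rewrite ?(cross_single AB uA) ?(cross_single AB wA).
have eB : B = [set [set u; w]].
  apply/setP => E; rewrite inE; apply/idP/eqP => [/BE //|->].
  by rewrite -(BE _ FB).
split=> //; move: nAB; rewrite eB cards1 ltnS leqn0 cards_eq0 => /eqP nA0.
have nB2 : 2 <= #|nonsingle B|.
  apply: (@uniq_size_le_card _ [:: u; w]); rewrite /= ?mem_seq1 ?uw // andbT.
  have neq v : [set v] \notin B.
    by apply/negP => /BE/(congr1 (fun E : {set T} => #|E|));
      rewrite cards1 cards2 uw.
  by rewrite !(@nonsingleE B [set u; w]) ?neq ?eB ?inE ?eqxx ?orbT.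
apply/eqP; rewrite eqEcard; apply/andP; split; last first.
  apply: leq_trans (_ : 3 <= _); last by move: nBA nB2; card_lia.
  rewrite -setUA !cardsU1 cards1.
  by case: (_ \notin _); case: (_ \notin _).
apply/subsetP => E EA.
have Euw : E \subset [set u; w].
  apply/subsetP => v vE; have := nonsingleE EA vE; rewrite nA0 in_set0.
  by move=> /esym/negbFE vA; have := cross_single AB vA FB; rewrite (BE _ FB).
have /andP[/card_gt0P[v vE] _] := smallP sA EA.
rewrite !inE; case: (boolP (u \in E)) => uE; case: (boolP (w \in E)) => wE.
- apply/orP; right; rewrite eqEsubset Euw; apply/subsetP => z.
  by rewrite !inE => /orP[] /eqP->.
- apply/orP; left; apply/orP; left; rewrite eqEsubset sub1set uE andbT.
  apply/subsetP => z zE; have := subsetP Euw _ zE; rewrite !inE.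
  by case/orP=> // /eqP zw; rewrite -zw zE in wE.
- apply/orP; left; apply/orP; right; rewrite eqEsubset sub1set wE andbT.
  apply/subsetP => z zE; have := subsetP Euw _ zE; rewrite !inE.
  by case/orP=> // /eqP zw; rewrite -zw zE in uE.
- by have := subsetP Euw _ vE; rewrite !inE => /orP[] /eqP ev;
    rewrite -ev vE in uE wE.
Qed.

(** All members of [B] contain [u], so [#|B| < #|nonsingle B|]. If [u] is also common to [A], the
    inequalities form an impossible cycle. Otherwise some [E] in [A] misses [u]; its points lie in
    [nonsingle A] and each member of [B] is [{u, y}] with [y] in [E], so
    [#|B| <= #|E| <= #|nonsingle A| < #|B|]. *)
Lemma single_no_single A B u :
    small A -> small B -> cross_intersecting A B -> B != set0 ->
    [set u] \in A -> (forall v, [set v] \in A -> v = u) ->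
    [set u] \notin B ->
    #|nonsingle A| < #|B| -> #|nonsingle B| < #|A| -> False.
Proof.
move=> sA sB AB B0 uA uniA uB nAB nBA.
have uBE E : E \in B -> u \in E by exact: cross_single AB uA.
have lB := card_common_nonsingle sB uBE uB B0.
case: (boolP [forall E in A, u \in E]) => [/forall_inP uAE|].
  by have := card_common sA uAE uA; move: lB nAB nBA; card_lia.
rewrite negb_forall => /existsP[E]; rewrite negb_imply => /andP[EA uE].
have /andP[E0 E2] := smallP sA EA.
have lA : #|E| <= #|nonsingle A|.
  apply/subset_leq_card/subsetP => v vE; rewrite (nonsingleE EA vE).
  by apply: contraNN uE => /uniA <-.
have E2' : #|B| <= #|E|.
  apply: leq_trans (leq_imset_card (fun y => [set u; y]) _).
  apply/subset_leq_card/subsetP => F FB; apply/imsetP.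
  have [y yE yF] := crossP AB EA FB; exists y => //.
  have /andP[_ F2] := smallP sB FB; apply: set2_eq => //; last exact: uBE.
  by apply: contraNneq uE => ->.
move: E0 E2 lA E2' lB nAB nBA; card_lia.
Qed.

(** Pairwise intersecting pairs form a star, with fewer edges than points, or a triangle, with three
    of each. *)
Lemma card_intersecting_pairs A :
  {in A, forall E, #|E| = 2} -> {in A &, forall E F, E :&: F != set0} ->
  #|A| <= #|cover A|.
Proof.
move=> A2 AI; case: (set_0Vmem A) => [->|[E EA]]; first by rewrite cards0.
have sA : small A by apply/forall_inP => F /A2->.
have meet F F' : F \in A -> F' \in A -> exists2 v, v \in F & v \in F'.
  by move=> FA F'A; have /set0Pn[v] := AI _ _ FA F'A; rewrite inE => /andP[]; exists v.
have nsA : nonsingle A = cover A.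
  apply/setP => v; rewrite inE; case: (_ \in cover A) => //=.
  by apply/negP => /A2; rewrite cards1.
have A0 : A != set0 by apply/set0Pn; exists E.
have common u : (forall F, F \in A -> u \in F) -> #|A| <= #|cover A|.
  move=> uA; rewrite -nsA; apply/ltnW/(card_common_nonsingle sA uA) => //.
  by apply/negP => /A2; rewrite cards1.
have /cards2P[u [v [uv eE]]] : #|E| == 2 by rewrite A2.
case: (boolP [forall F in A, u \in F]) => [/forall_inP /common //|].
rewrite negb_forall => /existsP[F]; rewrite negb_imply => /andP[FA uF].
case: (boolP [forall F in A, v \in F]) => [/forall_inP /common //|].
rewrite negb_forall => /existsP[F']; rewrite negb_imply => /andP[F'A vF'].
have vF : v \in F.
  by have [z] := meet _ _ EA FA; rewrite eE !inE => /orP[] /eqP->; rewrite ?(negPf uF).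
have uF' : u \in F'.
  by have [z] := meet _ _ EA F'A; rewrite eE !inE => /orP[] /eqP->; rewrite ?(negPf vF').
have [w wF wF'] := meet _ _ FA F'A.
have wu : w != u by apply: contraNneq uF => <-.
have wv : w != v by apply: contraNneq vF' => <-.
have eF : F = [set v; w] by apply: set2_eq; rewrite ?A2 // eq_sym.
have eF' : F' = [set u; w] by apply: set2_eq; rewrite ?A2 // eq_sym.
have U : uniq [:: u; v; w] by rewrite /= !inE negb_or uv ![_ == w]eq_sym wu wv.
apply: (@leq_trans 3).
  apply: leq_trans (_ : #|[set E; F; F']| <= 3); last first.
    by rewrite -setUA !cardsU1 cards1; do 2!case: (_ \notin _).
  apply/subset_leq_card/subsetP => Q QA; rewrite !inE.
  have [x1 x1Q] := meet _ _ QA EA; have [x2 x2Q] := meet _ _ QA FA.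
  have [x3 x3Q] := meet _ _ QA F'A; rewrite eE eF eF' !inE.
  have Q2 : #|Q| <= 2 by rewrite A2.
  have two a b : a \in Q -> b \in Q -> a != b -> Q == [set a; b].
    by move=> aQ bQ ab; apply/eqP; exact: set2_eq.
  have vw : v != w by rewrite eq_sym.
  have uw : u != w by rewrite eq_sym.
  do 3![case/orP=> /eqP ?; subst];
  by [rewrite (two u v) // ?orbT | rewrite (two v w) // ?orbT | rewrite (two u w) // ?orbT].
apply: (@uniq_size_le_card _ [:: u; v; w]) => //=; rewrite andbT.
by apply/and3P; split; apply/bigcupP; [exists F' | exists F | exists F].
Qed.

(** If two members of [A] are disjoint, they cover four points and each member of [B] joins one to
    the other, which leaves at most four sets. Otherwise [A] is intersecting. *)
Lemma card_cross_pairs A B :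
  small B -> {in A, forall E, #|E| = 2} -> cross_intersecting A B ->
  #|A| <= #|cover A| \/ #|B| <= #|cover A|.
Proof.
move=> sB A2 AB.
case: (boolP [forall E in A, forall F in A, E :&: F != set0]) => [AI|].
  left; apply: card_intersecting_pairs => // E F EA FA.
  by have /forall_inP/(_ E EA)/forall_inP/(_ F FA) := AI.
rewrite negb_forall => /existsP[E]; rewrite negb_imply negb_forall.
case/andP=> EA /existsP[F]; rewrite negb_imply negbK => /andP[FA /eqP EF].
right; apply: (@leq_trans #|E :|: F|); last first.
  apply/subset_leq_card/subsetP => v.
  by rewrite inE => /orP[] vE; apply/bigcupP; [exists E | exists F].
rewrite cardsU EF cards0 (A2 E) // (A2 F) //.
apply: leq_trans (_ : #|[set [set p.1; p.2] | p in setX E F]| <= _); last first.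
  by apply: leq_trans (leq_imset_card _ _) _; rewrite cardsX !A2.
apply/subset_leq_card/subsetP => Q QB; apply/imsetP.
have [u uE uQ] := crossP AB EA QB; have [v vF vQ] := crossP AB FA QB.
exists (u, v); first by rewrite in_setX uE.
have /andP[_ Q2] := smallP sB QB; apply: set2_eq => //.
by apply/eqP => /= uv; move: EF => /setP/(_ u); rewrite !inE uE uv vF.
Qed.

(** Without singletons [nonsingle] is [cover], and two uses of [card_cross_pairs] give
    [#|A| < #|B| < #|A|]. Two singletons in one family give a tetrahedron, and a lone singleton must
    by [single_no_single] occur in both families. *)
Lemma cross_intersecting_cases A B :
    small A -> small B -> cross_intersecting A B -> A != set0 -> B != set0 ->
    #|nonsingle A| < #|B| -> #|nonsingle B| < #|A| ->
  [\/ exists u w, [/\ u != w, A = [set [set u]; [set w]; [set u; w]] &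
        B = [set [set u; w]]],
      exists u w, [/\ u != w, B = [set [set u]; [set w]; [set u; w]] &
        A = [set [set u; w]]] |
      exists u, [/\ [set u] \in A, [set u] \in B & #|B| <= (#|nonsingle A|).+1]].
Proof.
move=> sA sB AB A0 B0 nAB nBA; have BA := cross_sym AB.
case: (pickP (fun u => [set u] \in A)) => [u uA|noA]; last first.
  case: (pickP (fun u => [set u] \in B)) => [u uB|noB]; last first.
    have pairs C : small C -> (forall u, ([set u] \in C) = false) ->
        {in C, forall E, #|E| = 2}.
      move=> sC noC E EC; have /andP[E0 E2] := smallP sC EC.
      suff : #|E| != 1 by move: E0 E2; card_lia.
      by apply/cards1P => -[v eE]; have := noC v; rewrite -eE EC.
    have ns (C : {set {set T}}) : (forall u, ([set u] \in C) = false) -> nonsingle C = cover C.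
      by move=> noC; apply/setP => v; rewrite inE noC andbT.
    rewrite (ns _ noA) in nAB; rewrite (ns _ noB) in nBA.
    have := card_cross_pairs sB (pairs _ sA noA) AB.
    have := card_cross_pairs sA (pairs _ sB noB) BA.
    move: nAB nBA; card_lia.
  case: (pickP (fun w => (w != u) && ([set w] \in B))) => [w /andP[wu wB]|uni].
    constructor 2; exists u, w; rewrite eq_sym.
    by have [] := @two_singles B A u w => //; rewrite eq_sym.
  exfalso; apply: (single_no_single sB sA BA A0 uB) => //; last by rewrite noA.
  by move=> v vB; apply/eqP; have := uni v; rewrite vB andbT; case: eqP.
case: (pickP (fun w => (w != u) && ([set w] \in A))) => [w /andP[wu wA]|uni].
  constructor 1; exists u, w; rewrite eq_sym.
  by have [] := @two_singles A B u w => //; rewrite eq_sym.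
have uniA v : [set v] \in A -> v = u.
  by move=> vA; apply/eqP; have := uni v; rewrite vA andbT; case: eqP.
case: (boolP ([set u] \in B)) => uB; last first.
  by exfalso; exact: (single_no_single sA sB AB B0 uA uniA uB).
constructor 3; exists u; split=> //.
have := card_common sB (fun E => cross_single AB uA) uB.
have := card_common sA (fun E => cross_single BA uB) uA.
move: nAB nBA; card_lia.
Qed.

End CrossIntersecting.

(** * Intersecting families outside every star *)

(** The exceptions of the theorem over an arbitrary finite type, so that the analysis of [G] need
    not mention ['I_n]. *)
Definition exceptional (T : finType) (H : {set {set T}}) : Prop :=
  (exists K : {set T},
     [/\ #|K| = 4, ksubsets K 3 \subset H,
         (forall A : {set T}, A \in H -> A \subset K \/ K :&: A = set0) &
         max_star H = 7])
  \/
  (exists K M : {set T},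
     [/\ #|K| = 3, M \subset ~: K, Zfamily K M \subset H &
         (K \notin H /\ max_star H = #|Zfamily K M| /\
          #|Zfamily K M| = 3 * #|M| + 3)
         \/
         (K \in H /\ max_star H = #|Zfamily K M| + 1 /\
          #|Zfamily K M| + 1 = 3 * #|M| + 4)]).

Section NonStar.
Variables (T : finType) (H G : {set {set T}}).
Hypothesis H3 : H \subset subsets_le T 3.
Hypothesis Hdown : downset H.
Hypothesis GH : G \subset H.
Hypothesis GI : intersecting G.
Hypothesis nostar : forall x, ~~ (G \subset star H x).
Hypothesis Gmax : forall x, #|star H x| <= #|G|.
Implicit Types (S A K : {set T}) (x y z a b u w : T).

Lemma down A S : A \in H -> S \subset A -> S \in H.
Proof. by move=> AH; apply/implyP; have /forall_inP/(_ A AH)/forallP/(_ S) := Hdown. Qed.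

Lemma GsubH S : S \in G -> S \in H.
Proof. exact: (subsetP GH). Qed.

Lemma G_meets : {in G &, forall A S, A :&: S != set0}.
Proof. by move=> A S AG SG; have /forall_inP/(_ A AG)/forall_inP/(_ S SG) := GI. Qed.

(** A member with at most one point is some [{x}], since [G] is intersecting, and then all of [G]
    lies in the star at [x]. *)
Lemma G_card S : S \in G -> 1 < #|S| <= 3.
Proof.
move=> SG; have := subsetP H3 _ (GsubH SG); rewrite inE => -> /=.
rewrite andbT ltnNge; apply/negP => S1.
have /set0Pn[x] := G_meets SG SG; rewrite setIid => xS.
have /negP := nostar x; apply; apply/subsetP => A AG; rewrite inE GsubH //=.
have [z zA zS] := meets G_meets AG SG.
have /subsetP/(_ z) : S \subset [set x].
  by rewrite -(_ : [set x] = S) //; apply/eqP; rewrite eqEcard sub1set xS cards1.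
by move=> /(_ zS); rewrite inE => /eqP <-.
Qed.

(** Both sides count [G :|: star H x]. *)
Lemma card_star_diff x :
  #|G| + #|star H x :\: G| = #|star H x| + #|avoid G x|.
Proof.
rewrite -(cardsID G (star H x)) -(card_star_avoid G x).
have -> : star H x :&: G = star G x; last by card_lia.
apply/setP => S; rewrite !inE andbC andbA; congr (_ && _).
by case: (boolP (S \in G)) => //= /GsubH.
Qed.

(* The pairs of [H] at [x] that a star gains over [G]; [free_sets x] adds [{x}]. *)
Definition free_pairs x := [set v | (v != x) && ([set x; v] \in H :\: G)].

Definition free_sets x := [set x] |: [set [set x; v] | v in free_pairs x].

Lemma card_free_sets x : #|free_sets x| = (#|free_pairs x|).+1.
Proof.
rewrite cardsU1 card_in_imset.
  rewrite (_ : _ \notin _ = true) //; apply/imsetP => -[v].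
  rewrite inE => /andP[vx _] /(congr1 (fun A : {set T} => #|A|)).
  by rewrite cards1 cards2 eq_sym vx.
move=> v w; rewrite !inE => /andP[vx _] /andP[wx _] /setP/(_ v).
by rewrite !inE eqxx orbT (negPf vx) /= => /esym/eqP.
Qed.

Lemma free_sets_sub x S : S \in G -> x \in S -> free_sets x \subset star H x :\: G.
Proof.
move=> SG xS; apply/subsetP => A; rewrite in_setU1 !inE.
case/orP=> [/eqP->|/imsetP[v]].
  rewrite inE eqxx andbT (down (GsubH SG)) ?sub1set // andbT.
  by apply/negP => /G_card; rewrite cards1.
by rewrite !inE => /and3P[_ nG iH] ->; rewrite nG iH !inE eqxx.
Qed.

(** By [Gmax] the star at [x] gains at most [#|avoid G x|] sets over [G], and the free sets are
    among them. The singleton [{x}] makes the inequality strict. *)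
Lemma free_pairs_lt S x : S \in G -> x \in S -> #|free_pairs x| < #|avoid G x|.
Proof.
move=> SG xS; have := subset_leq_card (free_sets_sub SG xS).
have := card_star_diff x; have := Gmax x; rewrite card_free_sets.
card_lia.
Qed.

(** Equality case of [free_pairs_lt]: the free sets make the star at [x] as large as [G]. *)
Lemma max_starE S x : S \in G -> x \in S -> #|avoid G x| <= (#|free_pairs x|).+1 ->
  max_star H = #|G|.
Proof.
move=> SG xS; have := subset_leq_card (free_sets_sub SG xS).
have := card_star_diff x; rewrite card_free_sets => e1 e2 e3.
apply/eqP; rewrite eqn_leq; apply/andP; split.
  by apply/bigmax_leqP => y _; exact: Gmax.
apply: leq_trans (leq_bigmax x).
by move: e1 e2 e3; card_lia.
Qed.

(** * A triangle of pairs in [G] *)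

Section Triangle.
Variable K : {set T}.
Hypothesis K3 : #|K| = 3.
Hypothesis KG : forall x, x \in K -> K :\ x \in G.

(* Each inequality at a vertex [x] of [K] bounds the union of the other two sets
   [D y] by [#|D x|], which forces all three to coincide. *)
Let D x := [set m | (m \notin K) && (m |: (K :\ x) \in H)].

Lemma K_third y z : y \in K -> z \in K -> y != z ->
  exists x, [/\ x \in K, x != y & x != z].
Proof.
move=> yK zK yz; have [x [xy xz eK]] := card3P K3 yK zK yz.
by exists x; split=> //; rewrite eK !inE eqxx orbT.
Qed.

(** For each other [y] in [K], [S] meets the pair [{x, y}] of [G], necessarily in [y]. *)
Lemma K_pair S x : S \in G -> x \in K -> x \notin S -> K :\ x \subset S.
Proof.
move=> SG xK xS; apply/subsetP => y; rewrite in_setD1 => /andP[yx yK].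
have xy : x != y by rewrite eq_sym.
have [z [zx zy eK]] := card3P K3 xK yK xy.
have zK : z \in K by rewrite eK !inE eqxx orbT.
have [t] := meets G_meets (KG zK) SG; rewrite in_setD1 eK !inE.
case/andP=> tz /orP[/orP[]|] /eqP et; rewrite ?et // in tz *.
- by rewrite (negPf xS).
- by rewrite eqxx in tz.
Qed.

Lemma card_KD1 x : x \in K -> #|K :\ x| = 2.
Proof. by move=> xK; have := cardsD1 x K; rewrite K3 xK add1n => -[]. Qed.

Lemma exists_K_neq x : x \in K -> exists2 y, y \in K & x \in K :\ y.
Proof.
move=> xK; have /card_gt0P[y] : 0 < #|K :\ x| by rewrite card_KD1.
by rewrite in_setD1 => /andP[yx yK]; exists y; rewrite // in_setD1 eq_sym yx.
Qed.

Lemma avoid_K S x : x \in K -> S \in avoid G x ->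
  S = K :\ x \/ exists2 m, m \in D x & S = m |: (K :\ x).
Proof.
move=> xK; rewrite inE => /andP[SG xS]; have KS := K_pair SG xK xS.
case: (boolP (S \subset K :\ x)) => [SK|/subsetPn[m mS mK]].
  by left; apply/eqP; rewrite eqEsubset SK.
right; exists m; last first.
  apply/esym/eqP; rewrite eqEcard subUset sub1set mS KS cardsU1 mK card_KD1 //.
  by have /andP[] := G_card SG.
have mx : m != x by apply: contraNneq xS => <-.
rewrite in_setD1 mx /= in mK; rewrite inE mK.
by apply: down (GsubH SG) _; rewrite subUset sub1set mS.
Qed.

Lemma card_avoid_K x : x \in K -> #|avoid G x| <= (#|D x|).+1.
Proof.
move=> xK; apply: leq_trans (_ : #|K :\ x |: [set m |: (K :\ x) | m in D x]| <= _).
  apply/subset_leq_card/subsetP => S /(avoid_K xK)[->|[m mD ->]].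
    by rewrite in_setU1 eqxx.
  by rewrite in_setU1 (imset_f (fun m => m |: (K :\ x)) mD) orbT.
rewrite cardsU1; have := leq_imset_card (fun m => m |: (K :\ x)) (D x).
by case: (_ \notin _); card_lia.
Qed.

(** [{x, m}] lies below the triple that puts [m] in [D y], and it is not in [G] because it misses
    the pair [K :\ x]. *)
Lemma D_free x y : x \in K -> y \in K -> y != x -> D y \subset free_pairs x.
Proof.
move=> xK yK yx; apply/subsetP => m; rewrite inE => /andP[mK mH].
have mx : m != x by apply: contraNneq mK => ->.
have xy : x != y by rewrite eq_sym.
rewrite !inE mx /= andbC; apply/andP; split.
  by apply: down mH _; apply/subsetP => z; rewrite !inE => /orP[] /eqP->;
     rewrite ?eqxx // xy xK orbT.
apply/negP => xmG; have [t] := meets G_meets (KG xK) xmG.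
by rewrite in_setD1 !inE => /andP[tx tK] /orP[] /eqP et;
   [rewrite et eqxx in tx | rewrite et (negPf mK) in tK].
Qed.

Lemma free_pairs_K x : x \in K -> #|free_pairs x| <= #|D x|.
Proof.
move=> xK; have [y yK xKy] := exists_K_neq xK.
have := free_pairs_lt (KG yK) xKy; have := card_avoid_K xK.
by card_lia.
Qed.

Lemma D_sub y z : y \in K -> z \in K -> y != z -> D z \subset D y.
Proof.
move=> yK zK yz; have [x [xK xy xz]] := K_third yK zK yz.
have := subset_leq_card (D_free yK xK xy).
have := free_pairs_K xK; have := free_pairs_K yK.
have sub : D y :|: D z \subset free_pairs x.
  by rewrite subUset !D_free // eq_sym.
have := subset_leq_card sub => l1 l2 l3 l4.
(* The chain is [#|D y :|: D z| <= #|free_pairs x| <= #|D x| <= #|free_pairs y| <= #|D y|]. *)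
have : D y :|: D z == D y.
  by rewrite eq_sym eqEcard subsetUl; move: l1 l2 l3 l4; card_lia.
by move/eqP <-; exact: subsetUr.
Qed.

Lemma D_const y z : y \in K -> z \in K -> D y = D z.
Proof.
move=> yK zK; case: (eqVneq y z) => [->//|yz].
by apply/eqP; rewrite eqEsubset !D_sub // eq_sym.
Qed.

Lemma card_free_pairs_K x : x \in K -> #|free_pairs x| = #|D x|.
Proof.
move=> xK; have [y yK] := exists_K_neq xK; rewrite in_setD1 eq_sym => /andP[yx _].
apply/eqP; rewrite eqn_leq free_pairs_K // (D_const xK yK).
exact/subset_leq_card/D_free.
Qed.

Lemma card_avoid_KE x : x \in K -> #|avoid G x| = (#|D x|).+1.
Proof.
move=> xK; have [y yK xKy] := exists_K_neq xK.
apply/eqP; rewrite eqn_leq card_avoid_K //.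
by rewrite -card_free_pairs_K //; exact: free_pairs_lt (KG yK) xKy.
Qed.

(** [avoid_K] allows at most [#|D x| + 1] sets and by [card_avoid_KE] as many occur, so every
    candidate is in [G]. *)
Lemma D_G x m : x \in K -> m \in D x -> m |: (K :\ x) \in G.
Proof.
move=> xK mD; set F := K :\ x |: [set m |: (K :\ x) | m in D x].
have sub : avoid G x \subset F.
  apply/subsetP => S /(avoid_K xK)[->|[m' m'D ->]]; first by rewrite in_setU1 eqxx.
  by rewrite in_setU1 (imset_f (fun m => m |: (K :\ x)) m'D) orbT.
suff /eqP eF : avoid G x == F.
  have : m |: (K :\ x) \in avoid G x by rewrite eF in_setU1 (imset_f (fun m => m |: (K :\ x)) mD) orbT.
  by rewrite inE => /andP[].
rewrite eqEcard sub card_avoid_KE // cardsU1.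
have := leq_imset_card (fun m => m |: (K :\ x)) (D x).
by case: (_ \notin _); card_lia.
Qed.

(** Otherwise the star at [x] would gain [K] on top of its [#|D x| + 1] free sets, while only
    [#|D x| + 1] members of [G] avoid [x]. *)
Lemma K_in_G : K \in H -> K \in G.
Proof.
move=> KH; apply/negPn/negP => KnG.
have /card_gt0P[x xK] : 0 < #|K| by rewrite K3.
have [y yK xKy] := exists_K_neq xK.
have sub : K |: free_sets x \subset star H x :\: G.
  by rewrite subUset (free_sets_sub (KG yK)) // sub1set !inE KnG KH xK.
have := subset_leq_card sub; rewrite cardsU1 card_free_sets.
have -> : K \notin free_sets x.
  rewrite in_setU1 negb_or; apply/andP; split.
    by apply: contra_eqN K3 => /eqP->; rewrite cards1.
  apply/imsetP => -[v _ eK]; move: K3; rewrite eK cards2.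
  by case: (_ != _).
have := card_star_diff x; have := Gmax x.
rewrite card_avoid_KE // card_free_pairs_K //.
by card_lia.
Qed.

(** [D x0] serves as [M]; by [D_const] every vertex of [K] gives the same set. A member other than
    [K] has at most three points, so it misses some [x] in [K] and [avoid_K] describes it. *)
Lemma Zfamily_triangle x0 : x0 \in K -> Zfamily K (D x0) = G :\ K.
Proof.
move=> x0K; apply/setP => S; rewrite in_setD1; apply/idP/andP => [|[SK SG]].
  rewrite !inE => /orP[/andP[SK /eqP S2]|].
    have neSK : S != K by apply: contra_eqN S2 => /eqP->; rewrite K3.
    split=> //; have /subsetPn[x xK xS] : ~~ (K \subset S).
      by apply: contra neSK => KS; rewrite eqEsubset SK.
    suff /eqP-> : S == K :\ x by exact: KG.
    by rewrite eqEcard subsetD1 SK xS S2 card_KD1.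
  case/andP=> /andP[SKM /eqP S3] /eqP SK2.
  have neSK : S != K by apply: contra_eqN SK2 => /eqP->; rewrite setIid K3.
  split=> //; have /subsetPn[x xK xS] : ~~ (K \subset S).
    by apply: contra neSK => KS; rewrite eq_sym eqEcard KS S3 K3.
  have eSK : S :&: K = K :\ x.
    apply/eqP; rewrite eqEcard SK2 card_KD1 // subsetD1 subsetIr inE.
    by rewrite (negPf xS).
  have /card_gt0P[m] : 0 < #|S :\: K|.
    by have := cardsID K S; rewrite SK2 S3; card_lia.
  rewrite in_setD => /andP[mK mS].
  have mD : m \in D x.
    by have := subsetP SKM _ mS; rewrite in_setU (negPf mK) (D_const xK x0K).
  suff /eqP-> : S == m |: (K :\ x) by exact: D_G.
  rewrite eq_sym eqEcard S3 cardsU1 card_KD1 // -eSK in_setI (negPf mK) andbF.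
  by rewrite subUset sub1set mS subsetIl.
have /subsetPn[x xK xS] : ~~ (K \subset S).
  apply: contra SK => KS; rewrite eq_sym eqEcard KS K3.
  by have /andP[] := G_card SG.
have Sav : S \in avoid G x by rewrite inE SG.
case: (avoid_K xK Sav) => [eS|[m mD eS]].
  by rewrite in_setU; apply/orP; left; rewrite inE eS subD1set card_KD1.
have mK : m \notin K by move: mD; rewrite inE => /andP[].
have mKx : m \notin K :\ x by rewrite in_setD1 (negPf mK) andbF.
rewrite in_setU; apply/orP; right; rewrite inE inE; apply/andP; split.
  rewrite eS cardsU1 mKx card_KD1 // andbT subUset sub1set in_setU.
  by rewrite (D_const x0K xK) mD orbT (subset_trans (subD1set _ _) (subsetUl _ _)).
suff -> : S :&: K = K :\ x by rewrite card_KD1.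
apply/setP => z; rewrite eS !inE.
case: (eqVneq z m) => [->|_] /=; first by rewrite (negPf mK) !andbF.
by case: (z \in K); rewrite ?andbT ?andbF.
Qed.

(** Sum [#|star G x| + #|avoid G x| = #|G|] over [K]: a member other than [K] lies in two of the
    stars, and each vertex is avoided by [#|D x0| + 1] members. *)
Lemma card_Zfamily_triangle x0 : x0 \in K -> #|G :\ K| = 3 * #|D x0| + 3.
Proof.
move=> x0K; have sumA : \sum_(x in K) #|avoid G x| = 3 * (#|D x0|).+1.
  rewrite -[X in X * _]K3 -sum_nat_const; apply: eq_bigr => x xK.
  by rewrite card_avoid_KE // (D_const xK x0K).
have : \sum_(x in K) (#|star G x| + #|avoid G x|) = 3 * #|G|.
  by rewrite -[X in X * _]K3 -sum_nat_const; apply: eq_bigr => x _; exact: card_star_avoid.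
rewrite big_split /= sumA sum_card_star (big_setID [set K]) /=.
have -> : \sum_(S in G :\ K) #|S :&: K| = #|G :\ K| * 2.
  rewrite -sum_nat_const; apply: eq_bigr => S.
  rewrite in_setD1 => /andP[SK SG].
  have /subsetPn[x xK xS] : ~~ (K \subset S).
    apply: contra SK => KS; rewrite eq_sym eqEcard KS K3.
    by have /andP[] := G_card SG.
  suff -> : S :&: K = K :\ x by rewrite card_KD1.
  apply/eqP; rewrite eqEsubset subsetD1 subsetIr inE (negPf xS) /=.
  by rewrite subsetI subD1set andbT K_pair.
have := cardsD1 K G; case: (boolP (K \in G)) => KG' ->.
  by rewrite (setIidPr _) ?sub1set // big_set1 setIid K3; card_lia.
have -> : G :&: [set K] = set0.
  apply/setP => S; rewrite !inE. by case: (eqVneq S K) => [->|_]; rewrite ?andbF // (negPf KG').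
by rewrite big_set0; card_lia.
Qed.

Lemma exceptional_triangle : exceptional H /\ max_star H = #|G|.
Proof.
have /card_gt0P[x xK] : 0 < #|K| by rewrite K3.
have [y yK xKy] := exists_K_neq xK.
have mE : max_star H = #|G|.
  by apply: (max_starE (KG yK) xKy); rewrite card_avoid_KE // card_free_pairs_K.
split=> //; right; exists K, (D x); split=> //.
- by apply/subsetP => m; rewrite !inE => /andP[].
- rewrite (Zfamily_triangle xK).
  exact: subset_trans (subD1set _ _) GH.
rewrite (Zfamily_triangle xK) mE (card_Zfamily_triangle xK).
have := cardsD1 K G; rewrite (card_Zfamily_triangle xK).
case: (boolP (K \in H)) => KH.
  by rewrite (K_in_G KH) => ->; right; split=> //; card_lia.
by rewrite (negPf (contra (@GsubH K) KH)) => ->; left.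
Qed.

End Triangle.

Lemma not_free_pair a v : free_pairs a = set0 -> v != a -> [set a; v] \in H ->
  [set a; v] \in G.
Proof.
move=> fa va avH; apply/negPn/negP => avG.
have : v \in free_pairs a by rewrite inE va inE avG.
by rewrite fa inE.
Qed.

(** * The tetrahedron *)

Section Tetrahedron.
Variables a b u w : T.
Hypothesis ab : a != b.
Hypothesis bu : b != u.
Hypothesis bw : b != w.
Hypothesis au : a != u.
Hypothesis aw : a != w.
Hypothesis uw : u != w.
Hypothesis auG : [set a; u] \in G.
Hypothesis buwG : [set b; u; w] \in G.
Hypothesis G_cases : forall S, S \in G ->
  [|| S == [set a; u], S == [set a; w], S == [set a; u; w],
      S == [set b; u; w] | (a \in S) && (b \in S)].

Lemma avoid_apex : avoid G a = [set [set b; u; w]].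
Proof.
apply/setP => S; rewrite !inE; apply/andP/eqP => [[SG aS]|->]; last first.
  by rewrite buwG !inE !negb_or ab au aw.
have := G_cases SG; rewrite (negPf aS) /= orbF.
by case/or4P=> /eqP eS //; move: aS; rewrite eS !inE eqxx.
Qed.

(** Only [{b, u, w}] avoids [a], so [free_pairs_lt] leaves no room: all pairs of [H] at [a] belong
    to [G]. *)
Lemma free_apex : free_pairs a = set0.
Proof.
have aS : a \in [set a; u] by rewrite !inE eqxx.
have := free_pairs_lt auG aS; rewrite avoid_apex cards1 ltnS leqn0 cards_eq0.
by move/eqP.
Qed.

(** Only a member containing [a] and [b] is at issue. For a point [z] of it other than [a], the pair
    [{a, z}] is in [G] and must meet [{b, u, w}]. *)
Lemma sub_tetra S : S \in G -> S \subset [set a; b; u; w].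
Proof.
move=> SG; have := G_cases SG.
case/or4P=> [/eqP->|/eqP->|/eqP->|/orP[/eqP->|/andP[aS bS]]].
1-4: by apply/subsetP => z; rewrite !inE => H'; move: H'; case_eq_op z.
apply/subsetP => z zS; case: (eqVneq z a) => [->|za]; first by rewrite !inE eqxx.
have azH : [set a; z] \in H.
  by apply: down (GsubH SG) _; apply/subsetP => t; rewrite !inE => /orP[] /eqP->.
have := not_free_pair free_apex za azH => /(meets G_meets)/(_ buwG)[t].
rewrite !inE => /orP[] /eqP->; last by move=> H'; move: H'; case_eq_op z.
by rewrite (negPf ab) (negPf au) (negPf aw).
Qed.

(** [{u, w}] and [{u, b}] are in [H] below [{b, u, w}] but not in [G], where only [{b, u, w}] avoids
    [a]. These two free pairs force three members avoiding [u], and only three candidates lie inside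
    the tetrahedron. *)
Lemma avoid_u_eq :
  avoid G u = [set [set a; w]; [set a; b]; [set a; b; w]] /\
  #|avoid G u| <= (#|free_pairs u|).+1.
Proof.
have sub : avoid G u \subset [set [set a; w]; [set a; b]; [set a; b; w]].
  apply/subsetP => S; rewrite inE => /andP[SG uS].
  have := G_cases SG; have SK := subsetP (sub_tetra SG).
  case/or4P=> [/eqP eS|/eqP->|/eqP eS|/orP[/eqP eS|/andP[aS bS]]].
  - by rewrite eS !inE eqxx orbT in uS.
  - by rewrite !inE eqxx.
  - by rewrite eS !inE eqxx orbT in uS.
  - by rewrite eS !inE eqxx orbT in uS.
  have Sabw z : z \in S -> [|| z == a, z == b | z == w].
    move=> zS; have := SK _ zS; rewrite !inE.
    by case: (eqVneq z u) => [zu|_]; [rewrite -zu zS in uS | case_eq_op z].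
  rewrite !inE; apply/orP; case: (boolP (w \in S)) => wS; [right | left; apply/orP; right].
    rewrite eqEsubset; apply/andP; split; apply/subsetP => z.
      by move/Sabw; rewrite !inE; case_eq_op z.
    by rewrite !inE => /orP[/orP[]|] /eqP->.
  rewrite eqEsubset; apply/andP; split; apply/subsetP => z.
    move=> zS; move: (Sabw z zS); rewrite !inE.
    by case: (eqVneq z w) => [zw|_]; [rewrite -zw zS in wS | case_eq_op z].
  by rewrite !inE => /orP[] /eqP->.
have notG x y : x \in [set u; w] -> [set x; y] != [set b; u; w] -> y != a ->
    [set x; y] \notin G.
  move=> xuw xy ya; apply/negP => xyG.
  have : [set x; y] \in avoid G a.
    rewrite inE xyG !inE negb_or eq_sym [_ == y]eq_sym ya andbT.
    by move: xuw; rewrite !inE => /orP[] /eqP->; rewrite eq_sym ?au ?aw.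
  by rewrite avoid_apex inE (negPf xy).
have free2 : 2 <= #|free_pairs u|.
  apply: (@uniq_size_le_card _ [:: w; b]); first by rewrite /= mem_seq1 eq_sym bw.
  rewrite /= !inE bu eq_sym uw /= andbT.
  have sub_buw x : x \in [set b; w] -> [set u; x] \in H.
    move=> xbw; apply: down (GsubH buwG) _; apply/subsetP => t.
    by move: xbw; rewrite !inE => /orP[] /eqP-> /orP[] /eqP->; rewrite eqxx ?orbT.
  have neq x : x \in [set b; w] -> [set u; x] != [set b; u; w].
    move=> xbw; apply/eqP => /setP e; have := e b; have := e w.
    rewrite !inE !eqxx !orbT; move: xbw; rewrite !inE [w == u]eq_sym (negPf uw).
    by rewrite (negPf bu) => /orP[] /eqP-> /=; rewrite ?(negPf bw) // eq_sym (negPf bw).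
  by rewrite !notG ?sub_buw ?neq ?inE ?eqxx ?orbT // eq_sym.
have uS : u \in [set a; u] by rewrite !inE eqxx orbT.
have lt3 := free_pairs_lt auG uS.
have le3 : #|[set [set a; w]; [set a; b]; [set a; b; w]]| <= 3.
  by rewrite -setUA !cardsU1 cards1; do 2!case: (_ \notin _).
have := subset_leq_card sub => le_sub; split.
  by apply/eqP; rewrite eqEcard sub; move: free2 lt3 le3; card_lia.
by move: free2 lt3 le3 le_sub; card_lia.
Qed.

End Tetrahedron.

Lemma exceptional_tetrahedron a b u w :
    a != b -> b != u -> b != w -> a != u -> a != w -> u != w ->
    [set a; u] \in G -> [set a; w] \in G -> [set a; u; w] \in G ->
    [set b; u; w] \in G ->
    (forall S, S \in G ->
      [|| S == [set a; u], S == [set a; w], S == [set a; u; w],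
          S == [set b; u; w] | (a \in S) && (b \in S)]) ->
  exceptional H /\ max_star H = #|G|.
Proof.
move=> ab bu bw au aw uw auG awG auwG buwG G_cases.
have [avu max_u] := avoid_u_eq ab bu bw au aw uw auG buwG G_cases.
(* The hypotheses are symmetric in [u] and [w]. *)
have [avw _] : avoid G w = [set [set a; u]; [set a; b]; [set a; b; u]] /\
    #|avoid G w| <= (#|free_pairs w|).+1.
  apply: avoid_u_eq; rewrite // 1?eq_sym // 1?setUAC // => S /G_cases.
  by rewrite -![[set _; w; u]]setUA [[set w; u]]setUC !setUA; case_eq_op S.
have subK := sub_tetra ab au aw auG buwG G_cases.
have abwG : [set a; b; w] \in G.
  have : [set a; b; w] \in avoid G u by rewrite avu !inE eqxx !orbT.
  by rewrite inE => /andP[].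
have abuG : [set a; b; u] \in G.
  have : [set a; b; u] \in avoid G w by rewrite avw !inE eqxx !orbT.
  by rewrite inE => /andP[].
have uS : u \in [set a; u] by rewrite !inE eqxx orbT.
have mE : max_star H = #|G| := max_starE auG uS max_u.
pose K := [set a; b; u; w].
have K4 : #|K| = 4.
  rewrite /K -!setUA !cardsU1 cards1 !inE !negb_or ab au aw bu bw uw.
  by [].
have KG z : z \in K -> K :\ z \in G.
  have e x p q r : [set p; q; r] \in G -> uniq [:: x; p; q; r] -> x \in K ->
      K :\ x \in G.
    move=> RG /= /and4P[xR pR qR _] xK; suff /eqP<- : [set p; q; r] == K :\ x by [].
    have Kx := cardsD1 x K; rewrite xK K4 add1n in Kx; case: Kx => Kx.
    rewrite eqEcard subsetD1 (subK _ RG) -Kx -setUA !cardsU1 cards1.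
    by move: xR pR qR; rewrite !inE ?orbA => -> -> ->.
  have U : uniq [:: a; b; u; w] by rewrite /= !inE !negb_or ab au aw bu bw uw.
  move=> zK; move: (zK); rewrite {1}/K !inE.
  case/orP=> [/orP[/orP[]|]|] /eqP ez; move: zK; rewrite ez.
  - by apply: (e _ _ _ _ buwG).
  - by apply: (e _ _ _ _ auwG); distinct U.
  - by apply: (e _ _ _ _ abwG); distinct U.
  - by apply: (e _ _ _ _ abuG); distinct U.
have tripleH : ksubsets K 3 \subset H.
  apply/subsetP => A; rewrite inE => /andP[AK /eqP A3].
  have /subsetPn[z zK zA] : ~~ (K \subset A).
    by apply/negP => /subset_leq_card; rewrite K4 A3.
  apply: down (GsubH (KG z zK)) _; rewrite subsetD1 AK //.
(* The sets through [x] inside [K], other than [K] itself: [2 ^ 3 - 1] of them, all in [H]. *)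
pose P x := [set x |: B | B in powerset (K :\ x) :\ (K :\ x)].
have P7 x : x \in K -> #|P x| = 7.
  move=> xK; rewrite card_in_imset.
    have := cardsD1 (K :\ x) (powerset (K :\ x)); rewrite card_powerset inE subxx.
    by have := cardsD1 x K; rewrite xK K4 add1n => -[<-] [].
  move=> B C; rewrite in_setD1 inE subsetD1 => /and3P[_ _ xB].
  rewrite in_setD1 inE subsetD1 => /and3P[_ _ xC] eBC.
  by rewrite -(setU1K xB) eBC setU1K.
have Psub x : x \in K -> P x \subset star H x.
  move=> xK; apply/subsetP => A /imsetP[B].
  rewrite in_setD1 inE => /andP[BKx BK] ->; rewrite !inE eqxx andbT.
  have /subsetPn[z zK zB] : ~~ (K :\ x \subset B).
    by apply: contra BKx => KB; rewrite eqEsubset BK.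
  move: zK; rewrite in_setD1 => /andP[zx zK].
  apply: down (GsubH (KG z zK)) _; rewrite subUset sub1set in_setD1 eq_sym zx xK.
  by rewrite subsetD1 zB (subset_trans BK) ?subD1set.
have PK x A : x \in K -> A \in P x -> A \subset K.
  move=> xK /imsetP[B]; rewrite in_setD1 inE => /andP[_ BK] ->.
  by rewrite subUset sub1set xK (subset_trans BK) ?subD1set.
(* At most four members contain [u] and at most three avoid it. *)
have G7 : #|G| <= 7.
  rewrite -(card_star_avoid G u) avu.
  apply: (@leq_trans (4 + 3)) => //; apply: leq_add; last first.
    by rewrite -setUA !cardsU1 cards1; do 2!case: (_ \notin _).
  apply: leq_trans (_ : #|[set [set a; u]; [set a; u; w]; [set b; u; w]; [set a; b; u]]| <= 4).
    apply/subset_leq_card/subsetP => S; rewrite inE => /andP[SG uS'].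
    have := G_cases S SG.
    case/or4P=> [/eqP->|/eqP eS|/eqP->|/orP[/eqP->|/andP[aS bS]]]; rewrite ?inE ?eqxx ?orbT //.
      by move: uS'; rewrite eS !inE (negPf uw) eq_sym (negPf au).
    suff /eqP-> : [set a; b; u] == S by rewrite eqxx !orbT.
    rewrite eqEcard !subUset !sub1set aS bS uS' /=.
    have /andP[_ S3] := G_card SG; apply: leq_trans S3 _.
    by rewrite -setUA !cardsU1 cards1 !inE negb_or ab au bu.
  by rewrite -!setUA !cardsU1 cards1; do 3!case: (_ \notin _).
have uK : u \in K by rewrite !inE eqxx !orbT.
have m7 : max_star H = 7.
  apply/eqP; rewrite mE eqn_leq G7 -(P7 u uK).
  exact: leq_trans (subset_leq_card (Psub u uK)) (Gmax u).
split=> //; left; exists K; split=> // A AH.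
case: (set_0Vmem (K :&: A)) => [|[x]]; first by right.
(* A set of [H] that meets [K] in [x] and leaves [K] would be an eighth member of the star at
   [x]. *)
rewrite inE => /andP[xK xA]; left; apply/negPn/negP => AK.
have : A |: P x \subset star H x by rewrite subUset sub1set Psub // !inE AH xA.
move=> /subset_leq_card; rewrite cardsU1 P7 // (contra (PK x A xK) AK).
move=> /leq_trans/(_ (Gmax x)); by rewrite -mE m7.
Qed.

(** * Families covered by two points *)

Definition cover2 a b := forall S, S \in G -> (a \in S) || (b \in S).

(** Meant under [cover2 a b]: the members avoiding [b] then all contain [a], so removing [a] is
    injective. *)
Definition link a b := [set S :\ a | S in avoid G b].

Lemma cover2C a b : cover2 a b -> cover2 b a.
Proof. by move=> c S /c; rewrite orbC. Qed.

Lemma avoid_cover2 a b S : cover2 a b -> S \in avoid G b -> S \in G /\ a \in S.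
Proof.
by move=> c; rewrite inE => /andP[SG bS]; have := c S SG; rewrite (negPf bS) orbF.
Qed.

Lemma linkP a b E : cover2 a b ->
  reflect [/\ a |: E \in G, a \notin E & b \notin a |: E] (E \in link a b).
Proof.
move=> c; apply: (iffP imsetP) => [[S Sav ->]|[EG aE bE]].
  have [SG aS] := avoid_cover2 c Sav; rewrite setD1K // !inE eqxx.
  by move: Sav; rewrite inE => /andP[].
by exists (a |: E); rewrite ?setU1K // inE EG.
Qed.

Lemma card_link a b : cover2 a b -> #|link a b| = #|avoid G b|.
Proof.
move=> c; rewrite card_in_imset // => S R /(avoid_cover2 c)[_ aS].
by move=> /(avoid_cover2 c)[_ aR] e; rewrite -(setD1K aS) e setD1K.
Qed.

Lemma small_link a b : cover2 a b -> small (link a b).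
Proof.
move=> c; apply/forall_inP => E /(linkP _ c)[/G_card + aE _].
by rewrite cardsU1 aE.
Qed.

Lemma cross_link a b : cover2 a b -> cross_intersecting (link a b) (link b a).
Proof.
move=> c; apply/forall_inP => E /(linkP _ c)[EG _ bE].
apply/forall_inP => F /(linkP _ (cover2C c))[FG _ aF].
have [t] := meets G_meets EG FG; rewrite in_setU1 => tE tF.
apply/set0Pn; exists t; rewrite inE; apply/andP; split.
  by case/orP: tE => // /eqP ta; rewrite ta (negPf aF) in tF.
move: tF; rewrite in_setU1 => /orP[] // /eqP tb.
by move: bE; rewrite in_setU1 -tb tE.
Qed.

Lemma avoid_neq0 a : avoid G a != set0.
Proof.
have /subsetPn[S SG] := nostar a.
by rewrite inE GsubH //= => aS; apply/set0Pn; exists S; rewrite inE SG.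
Qed.

Lemma link_neq0 a b : cover2 a b -> link a b != set0.
Proof. by move=> c; rewrite -card_gt0 card_link // card_gt0 avoid_neq0. Qed.

(** [{a, v}] is in [H] below a member, and in [G] only if [{v}] is in the link. Removing [b] on the
    right keeps the pair [{a, b}] in reserve for [exceptional_cover2]. *)
Lemma nonsingle_link a b : cover2 a b ->
  nonsingle (link a b) \subset free_pairs a :\ b.
Proof.
move=> c; apply/subsetP => v; rewrite inE => /andP[/bigcupP[E EA vE] vA].
have /(linkP _ c)[EG aE bE] := EA.
have va : v != a by apply: contraNneq aE => <-.
have vb : v != b by apply: contraNneq bE => <-; rewrite in_setU1 vE orbT.
have ba : b != a by apply: contraNneq bE => ->; rewrite in_setU1 eqxx.
rewrite in_setD1 vb !inE va /=; apply/andP; split.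
  apply: contra vA => avG; apply/(linkP _ c); split=> //.
    by rewrite inE eq_sym.
  by rewrite !inE negb_or ba eq_sym.
by apply: down (GsubH EG) _; rewrite setUS // sub1set.
Qed.

Lemma nonsingle_link_lt a b : cover2 a b -> #|nonsingle (link a b)| < #|link b a|.
Proof.
move=> c; rewrite (card_link (cover2C c)).
have /set0Pn[S Sav] := avoid_neq0 b; have [SG aS] := avoid_cover2 c Sav.
apply: leq_ltn_trans (free_pairs_lt SG aS).
exact: leq_trans (subset_leq_card (nonsingle_link c)) (subset_leq_card (subD1set _ _)).
Qed.

Lemma link_tetrahedron a b u w : cover2 a b -> a != b -> u != w ->
  link a b = [set [set u]; [set w]; [set u; w]] -> link b a = [set [set u; w]] ->
  exceptional H /\ max_star H = #|G|.
Proof.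
move=> c ab uw eA eB.
have uA : [set u] \in link a b by rewrite eA !inE eqxx.
have wA : [set w] \in link a b by rewrite eA !inE eqxx orbT.
have uwA : [set u; w] \in link a b by rewrite eA !inE eqxx !orbT.
have uwB : [set u; w] \in link b a by rewrite eB inE.
have [auG] := linkP _ c uA; rewrite !inE negb_or => au /andP[_ bu].
have [awG] := linkP _ c wA; rewrite !inE negb_or => aw /andP[_ bw].
have [auwG _ _] := linkP _ c uwA; have [buwG _ _] := linkP _ (cover2C c) uwB.
rewrite !setUA in auwG buwG.
apply: (@exceptional_tetrahedron a b u w) => // S SG.
case: (boolP (b \in S)) => bS.
  case: (boolP (a \in S)) => aS; first by rewrite !orbT.
  have : S :\ b \in link b a by apply: imset_f; rewrite inE SG.
  rewrite eB inE => /eqP eS.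
  by rewrite -(setD1K bS) eS setUA eqxx !orbT.
have aS : a \in S by have := c S SG; rewrite (negPf bS) orbF.
have : S :\ a \in link a b by apply: imset_f; rewrite inE SG.
rewrite eA !inE => /orP[/orP[]|] /eqP eS; rewrite -(setD1K aS) eS ?setUA eqxx ?orbT //.
Qed.

Lemma exceptional_cover2 a b : cover2 a b -> a != b -> exceptional H /\ max_star H = #|G|.
Proof.
move=> c ab; have c' := cover2C c.
have [] := cross_intersecting_cases (small_link c) (small_link c') (cross_link c)
  (link_neq0 c) (link_neq0 c') (nonsingle_link_lt c) (nonsingle_link_lt c').
- by move=> [u [w [uw eA eB]]]; exact: (link_tetrahedron c ab uw).
- by move=> [u [w [uw eB eA]]]; apply: (link_tetrahedron c' _ uw eB eA); rewrite eq_sym.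
move=> [u [uA uB leB]].
have [auG] := linkP _ c uA; rewrite !inE negb_or => au /andP[_ bu].
have [buG _ _] := linkP _ c' uB.
(* [{a, u}] and [{b, u}] are in [G]; together with [{a, b}] they form a triangle. *)
case: (boolP ([set a; b] \in G)) => abG.
  have U : uniq [:: a; b; u] by rewrite /= !inE negb_or ab au bu.
  apply: (@exceptional_triangle [set a; b; u]).
    by rewrite -setUA !cardsU1 cards1 !inE negb_or ab au bu.
  have e x p q r s t : [set p; q] \in G -> [set r; s; t] = x |: [set p; q] ->
      uniq [:: x; p; q] -> [set r; s; t] :\ x \in G.
    move=> pqG -> /andP[xpq _]; rewrite setU1K //.
    by move: xpq; rewrite !inE.
  move=> x; rewrite !inE => /orP[/orP[]|] /eqP->.
  - by apply: (e _ b u) => //; rewrite setUA.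
  - by apply: (e _ a u) => //; [rewrite setUA [[set b; a]]setUC | distinct U].
  - by apply: (e _ a b) => //; [rewrite setUC | distinct U].
(* If [{a, b}] is in [H] but not in [G], it is a free pair at [a] beyond those counted by
   [nonsingle], which contradicts [leB]. *)
case: (boolP ([set a; b] \in H)) => abH.
  have bf : b \in free_pairs a by rewrite !inE eq_sym ab abG abH.
  have := subset_leq_card (nonsingle_link c).
  have aS : a \in [set a; u] by rewrite !inE eqxx.
  have := free_pairs_lt auG aS; have := cardsD1 b (free_pairs a); rewrite bf.
  by move: leB; rewrite (card_link c'); card_lia.
(* If [{a, b}] is not in [H], no member contains both points, and then [u] is common to all of
   [G]. *)
have /negP[] := nostar u; apply/subsetP => S SG; rewrite inE GsubH //=.
case: (boolP (b \in S)) => bS.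
  case: (boolP (a \in S)) => aS.
    case/negP: abH; apply: down (GsubH SG) _.
    by rewrite subUset !sub1set aS bS.
  have : S :\ b \in link b a by apply: imset_f; rewrite inE SG.
  by move/(cross_single (cross_link c) uA); rewrite in_setD1 => /andP[].
have aS : a \in S by have := c S SG; rewrite (negPf bS) orbF.
have : S :\ a \in link a b by apply: imset_f; rewrite inE SG.
by move/(cross_single (cross_link c') uB); rewrite in_setD1 => /andP[].
Qed.

Lemma exceptional_of_nonstar (x0 : T) : exceptional H /\ max_star H = #|G|.
Proof.
case: (boolP [exists a, exists b, (a != b) && [forall S in G, (a \in S) || (b \in S)]]).
  case/existsP=> a /existsP[b /andP[ab /forall_inP c]].
  exact: (exceptional_cover2 c ab).
move=> nocover.
(* The case [u = v] comes from [nostar], the other from the absence of a two-point cover. *)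
have tau3 u v : exists2 S, S \in G & (u \notin S) && (v \notin S).
  case: (eqVneq u v) => [<-|uv].
    have /set0Pn[S] := avoid_neq0 u; rewrite inE => /andP[SG uS].
    by exists S; rewrite ?uS.
  move: nocover; rewrite negb_exists => /forallP/(_ u); rewrite negb_exists.
  move=> /forallP/(_ v); rewrite uv /= negb_forall => /existsP[S].
  by rewrite negb_imply negb_or => /andP[SG uvS]; exists S.
(* A pair in [G] would itself be a two-point cover. *)
have G3 : {in G, forall S : {set T}, #|S| = 3}.
  move=> S SG; have /andP[S1 S3] := G_card SG; apply/eqP; rewrite eqn_leq S3.
  rewrite ltnNge; apply/negP => S2.
  have /cards2P[u [v [uv eS]]] : #|S| == 2 by rewrite eqn_leq S2.
  have [R RG /andP[uR vR]] := tau3 u v.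
  have [t] := meets G_meets SG RG.
  by rewrite eS !inE => /orP[] /eqP->; rewrite ?(negPf uR) ?(negPf vR).
have [x [[S SG xS] le]] := exists_card_avoid_le_nbhd G3 G_meets tau3 x0.
(* As [G] has no pairs, each neighbour of [x] gives a free pair, and [#|nbhd G x| <= #|free_pairs x|
   < #|avoid G x| <= #|nbhd G x|] is absurd. *)
suff sub : nbhd G x \subset free_pairs x.
  exfalso; move: (subset_leq_card sub) (free_pairs_lt SG xS) le; card_lia.
apply/subsetP => v /nbhdP[vx [R [RG xR vR]]]; rewrite !inE vx /=.
apply/andP; split; last by apply: down (GsubH RG) _; rewrite subUset !sub1set xR.
by apply/negP => /G3; rewrite cards2; case: (_ != _).
Qed.

End NonStar.

(** * Maximum intersecting families and stars *)

Lemma star_sub (T : finType) (H : {set {set T}}) x : star H x \subset H.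
Proof. by apply/subsetP => A; rewrite inE => /andP[]. Qed.

Lemma intersecting_star (T : finType) (H : {set {set T}}) x : intersecting (star H x).
Proof.
apply/forall_inP => A; rewrite inE => /andP[_ xA].
apply/forall_inP => B; rewrite inE => /andP[_ xB].
by apply/set0Pn; exists x; rewrite inE xA.
Qed.

Theorem theorem1p4 (n : nat) (hn : 1 <= n) (H : {set {set 'I_n}})
  (H_le3 : H \subset subsets_le 'I_n 3) (H_down : downset H) :
  EKR H /\
  (~ ((exists K : {set 'I_n},
         [/\ #|K| = 4,
             ksubsets K 3 \subset H,
             (forall A : {set 'I_n}, A \in H -> A \subset K \/ K :&: A = set0) &
             max_star H = 7])
      \/
      (exists K M : {set 'I_n},
         [/\ #|K| = 3,
             M \subset ~: K,
             Zfamily K M \subset H &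
             (K \notin H /\
              max_star H = #|Zfamily K M| /\
              #|Zfamily K M| = 3 * #|M| + 3)
             \/
             (K \in H /\
              max_star H = #|Zfamily K M| + 1 /\
              #|Zfamily K M| + 1 = 3 * #|M| + 4)]))
   -> strictly_EKR H).
Proof.
have G_cases (G : {set {set 'I_n}}) : G \subset H -> intersecting G ->
    max_star H <= #|G| -> (forall x, ~~ (G \subset star H x)) ->
    exceptional H /\ max_star H = #|G|.
  move=> GH GI leG nostar; apply: exceptional_of_nonstar (Ordinal hn) => // x.
  exact: leq_trans (leq_bigmax x) leG.
have starGP (G : {set {set 'I_n}}) :
    (exists x, G \subset star H x) \/ (forall x, ~~ (G \subset star H x)).
  case: (boolP [exists x, G \subset star H x]) => [/existsP|]; first by left.
  by rewrite negb_exists => /forallP; right.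
have ekr : EKR H.
  apply/eqP; rewrite eqn_leq; apply/andP; split; apply/bigmax_leqP.
    move=> G /andP[GH GI]; case: (starGP G) => [[x Gx]|nostar].
      exact: leq_trans (subset_leq_card Gx) (leq_bigmax x).
    (* A counterexample would exceed every star, but [G_cases] gives it the size [max_star H]. *)
    rewrite leqNgt; apply/negP => lt; have [_ e] := G_cases _ GH GI (ltnW lt) nostar.
    by rewrite e ltnn in lt.
  move=> x _; rewrite /max_intersecting.
  by apply: (@leq_bigmax_cond _ _ (fun G : {set {set 'I_n}} => #|G|));
     rewrite star_sub intersecting_star.
split=> // noexc; split=> // G GH GI; rewrite ekr => eG.
case: (starGP G) => [[x Gx]|nostar].
  (* A family of size [max_star H] inside a star fills that star. *)
  by exists x; apply/eqP; rewrite eqEcard Gx eG; exact: leq_bigmax.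
by case: noexc; have [] := G_cases _ GH GI _ nostar; rewrite ?eG.
Qed.
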